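(* The category $\mathcal{W}^*_1$ of von Neumann algebras is not locally presentable.
   Context: $\mathcal{W}^*_1$ is the category of von Neumann algebras ($W^*$-algebras, i.e. $C^*$-algebras that are dual Banach spaces; the zero algebra is allowed) with unital normal (i.e. weak$^*$-continuous) $*$-homomorphisms as morphisms. Let $\kappa$ be an (infinite) regular cardinal. A poset is $\kappa$-directed if every subset of cardinality $<\kappa$ has an upper bound; a $\kappa$-directed colimit is a colimit of a functor from a $\kappa$-directed poset. An object $c$ of a category $\mathcal{C}$ is $\kappa$-presentable if $\mathrm{hom}_{\mathcal{C}}(c,-):\mathcal{C}\to\mathrm{Set}$ preserves $\kappa$-directed colimits. A category is locally $\kappa$-presentable if it is cocomplete and has a set $S$ of $\kappa$-presentable objects such that every object is a $\kappa$-directed colimit of objects from $S$; it is locally presentable if it is locally $\kappa$-presentable for some regular cardinal $\kappa$. *)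

(* Defs.v *)
From HB Require Import structures.
From mathcomp Require Import all_boot all_order all_algebra.
From mathcomp Require Import complex.
From mathcomp Require Import all_classical all_reals all_analysis.
From Stdlib Require Import Relation_Definitions.

Set Implicit Arguments.
Unset Strict Implicit.
Unset Printing Implicit Defensive.

Import Order.TTheory GRing.Theory Num.Theory.
Import numFieldNormedType.Exports.

Local Open Scope classical_set_scope.
Local Open Scope card_scope.
Local Open Scope complex_scope.
Local Open Scope ring_scope.

(* One fixed universe, whose types play the role of "sets" as opposed to
   proper classes. Carriers of algebras, hom-sets, cardinals, diagram shapes
   and sets of generators are all taken in it; the types of objects of large
   categories are not. *)
Definition small := Type.

Record category (ob : Type) := Category {
  hom : ob -> ob -> small;
  idc : forall a, hom a a;
  (* diagrammatic order: f followed by g *)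
  hcomp : forall a b c, hom a b -> hom b c -> hom a c;
  comp_idl : forall a b (f : hom a b), hcomp (idc a) f = f;
  comp_idr : forall a b (f : hom a b), hcomp f (idc b) = f;
  comp_assoc : forall a b c d (f : hom a b) (g : hom b c) (h : hom c d),
    hcomp f (hcomp g h) = hcomp (hcomp f g) h
}.

Record functor (ob1 ob2 : Type) (C : category ob1) (D : category ob2) :=
  Functor {
  fob :> ob1 -> ob2;
  fmap : forall a b, hom C a b -> hom D (fob a) (fob b);
  fmap_id : forall a, fmap (idc C a) = idc D (fob a);
  fmap_comp : forall a b c (f : hom C a b) (g : hom C b c),
    fmap (hcomp f g) = hcomp (fmap f) (fmap g)
}.

Section functor_comp.
Context (ob1 ob2 ob3 : Type) (C : category ob1) (D : category ob2)
  (E : category ob3) (F : functor C D) (G : functor D E).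

Let map a b (f : hom C a b) : hom E (G (F a)) (G (F b)) := fmap G (fmap F f).

Let map_id a : map (idc C a) = idc E (G (F a)).
Proof. by rewrite /map !fmap_id. Qed.

Let map_comp a b c (f : hom C a b) (g : hom C b c) :
  map (hcomp f g) = hcomp (map f) (map g).
Proof. by rewrite /map !fmap_comp. Qed.

Definition functor_comp : functor C E :=
  @Functor _ _ C E (fun a => G (F a)) map map_id map_comp.
End functor_comp.

Definition set_category : category small :=
  @Category small (fun X Y => X -> Y) (fun _ => id)
    (fun _ _ _ f g => g \o f)
    (fun _ _ _ => erefl) (fun _ _ _ => erefl) (fun _ _ _ _ _ _ _ => erefl).

Section hom_functor.
Context (ob : Type) (C : category ob) (c : ob).

Let map a b (f : hom C a b) (g : hom C c a) : hom C c b := hcomp g f.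

Let map_id a : map (idc C a) = id.
Proof. by apply/funext => g; exact: comp_idr. Qed.

Let map_comp a b d (f : hom C a b) (g : hom C b d) :
  map (hcomp f g) = map g \o map f.
Proof. by apply/funext => h; exact: comp_assoc. Qed.

Definition hom_functor : functor C set_category :=
  @Functor _ _ C set_category (hom C c) map map_id map_comp.
End hom_functor.

Definition poset_category (J : small) (le : relation J) (leo : order J le) :
    category J :=
  @Category J le (ord_refl J le leo) (ord_trans J le leo)
    (fun _ _ _ => Prop_irrelevance _ _) (fun _ _ _ => Prop_irrelevance _ _)
    (fun _ _ _ _ _ _ _ => Prop_irrelevance _ _).

Record cocone (I ob : Type) (J : category I) (C : category ob)
    (F : functor J C) := Cocone {
  apex : ob;
  leg : forall i, hom C (F i) apex;
  leg_natural : forall i j (u : hom J i j), hcomp (fmap F u) (leg j) = leg i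
}.

Definition is_colimit (I ob : Type) (J : category I) (C : category ob)
    (F : functor J C) (x : cocone F) : Prop :=
  forall y : cocone F, exists! h : hom C (apex x) (apex y),
    forall i, hcomp (leg x i) h = leg y i.

Section map_cocone.
Context (I ob1 ob2 : Type) (J : category I) (C : category ob1)
  (D : category ob2) (F : functor J C) (G : functor C D) (x : cocone F).

Let map_leg i : hom D (functor_comp F G i) (G (apex x)) := fmap G (leg x i).

Let map_leg_natural i j (u : hom J i j) :
  hcomp (fmap (functor_comp F G) u) (map_leg j) = map_leg i.
Proof. by rewrite /map_leg /= -fmap_comp leg_natural. Qed.

Definition map_cocone : cocone (functor_comp F G) := Cocone map_leg_natural.
End map_cocone.

Definition cocomplete (ob : Type) (C : category ob) : Prop :=
  forall (I : small) (J : category I) (F : functor J C),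
    exists x : cocone F, is_colimit x.

(* A cardinal is represented by a type of that cardinality. *)

Definition card_lt (T U : Type) (A : set T) (B : set U) : Prop :=
  A #<= B /\ ~ (B #<= A).

(* An infinite cardinal that is not a sum of fewer smaller cardinals. *)
Definition regular_cardinal (K : small) : Prop :=
  infinite_set [set: K] /\
  forall (I : small) (X : I -> small),
    card_lt [set: I] [set: K] ->
    (forall i, card_lt [set: X i] [set: K]) ->
    card_lt [set: {i : I & X i}] [set: K].

Definition directed (K J : small) (le : relation J) : Prop :=
  forall A : set J, card_lt A [set: K] ->
    exists j, forall i, A i -> le i j.

Definition presentable (K : small) (ob : Type) (C : category ob) (c : ob) :
    Prop :=
  forall (J : small) (le : relation J) (leo : order J le), directed K le ->
  forall (F : functor (poset_category leo) C) (x : cocone F),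
    is_colimit x -> is_colimit (map_cocone (hom_functor C c) x).

Definition locally_presentable_at (K : small) (ob : Type) (C : category ob) :
    Prop :=
  cocomplete C /\
  exists (I : small) (S : I -> ob),
    (forall i, presentable K C (S i)) /\
    forall c : ob,
    exists (J : small) (le : relation J) (leo : order J le)
           (F : functor (poset_category leo) C) (x : cocone F),
      [/\ directed K le, forall j, exists i, F j = S i,
          apex x = c & is_colimit x].

Definition locally_presentable (ob : Type) (C : category ob) : Prop :=
  exists K : small, regular_cardinal K /\ locally_presentable_at K C.

(* The product is part of the mixin because the library's [algType] requires
   1 != 0, whereas the zero algebra is allowed here, and because a [pzRingType]
   cannot be joined with a normed module independently of [numDomainType]. *)
HB.mixin Record isCStarAlgebra (R : realType) A
    & CompleteNormedModule R[i] A := {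
  cone : A;
  cmul : A -> A -> A;
  star : A -> A;
  cmulA : associative cmul;
  cmul1l : left_id cone cmul;
  cmul1r : right_id cone cmul;
  cmulDl : left_distributive cmul +%R;
  cmulDr : right_distributive cmul +%R;
  cscaleAl : forall (k : R[i]) (x y : A), k *: cmul x y = cmul (k *: x) y;
  cscaleAr : forall (k : R[i]) (x y : A), k *: cmul x y = cmul x (k *: y);
  cnormM : forall x y : A, `|cmul x y| <= `|x| * `|y|;
  starK : involutive star;
  star_conj_linear : forall (k : R[i]) (x y : A),
    star (k *: x + y) = (k^*)%C *: star x + star y;
  starM : forall x y : A, star (cmul x y) = cmul (star y) (star x);
  cstar_identity : forall x : A, `|cmul (star x) x| = `|x| ^+ 2
}.

#[short(type="cstarAlgType")]
HB.structure Definition CStarAlgebra (R : realType) :=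
  {A of CompleteNormedModule R[i] A & isCStarAlgebra R A}.

(* Norms over R[i] take their values in R[i], hence the real part. *)
Definition dual_norm (R : realType) (V : normedModType R[i])
    (f : V -> R[i]^o) : R :=
  sup [set complex.Re `|f v| | v in [set v : V | `|v| <= 1]].

(* [ev] is an isometric linear isomorphism of [A] onto the dual of [V]. *)
Record is_dual_of (R : realType) (A V : completeNormedModType R[i])
    (ev : A -> {linear V -> R[i]^o}) : Prop := IsDualOf {
  ev_continuous : forall a, continuous (ev a);
  ev_linear : forall (k : R[i]) (a b : A) (v : V),
    ev (k *: a + b) v = k * ev a v + ev b v;
  ev_isometric : forall a, `|a| = (dual_norm (ev a))%:C;
  ev_surjective : forall f : {linear V -> R[i]^o}, continuous f ->
    exists a, ev a =1 f
}.

(* The realization of the algebra as a dual space is part of the data; the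
   predual being unique, the weak* topology does not depend on it. *)
Record wstarAlg (R : realType) := WStarAlg {
  carrier : small;
  cstar_class : CStarAlgebra R carrier;
  cstar_of : cstarAlgType R := CStarAlgebra.Pack cstar_class;
  predual : completeNormedModType R[i];
  ev : cstar_of -> {linear predual -> R[i]^o};
  ev_is_dual : is_dual_of ev
}.

Definition weak_star (R : realType) (A : wstarAlg R) : topologicalType :=
  initial_topology
    (fun a : cstar_of A => ev a : {ptws predual A -> R[i]^o}).

Record is_normal_star_hom (R : realType) (A B : wstarAlg R)
    (f : cstar_of A -> cstar_of B) : Prop := IsNormalStarHom {
  nsh_linear : linear f;
  nsh_mul : {morph f : x y / cmul x y};
  nsh_one : f cone = cone;
  nsh_star : {morph f : x / star x};
  nsh_normal : continuous (f : weak_star A -> weak_star B)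
}.

Definition wstar_hom (R : realType) (A B : wstarAlg R) : small :=
  {f : cstar_of A -> cstar_of B | is_normal_star_hom f}.

Section wstar_category.
Context (R : realType).
Implicit Types A B C D : wstarAlg R.

Let id_normal A : is_normal_star_hom (@id (cstar_of A)).
Proof. by split=> // x U. Qed.

Let comp_normal A B C (f : wstar_hom A B) (g : wstar_hom B C) :
  is_normal_star_hom (sval g \o sval f).
Proof.
case: f g => [f [fl fm f1 fs fn]] [g [gl gm g1 gs gn]] /=; split => /=.
- by move=> k x y /=; rewrite fl gl.
- by move=> x y /=; rewrite fm gm.
- by rewrite f1 g1.
- by move=> x /=; rewrite fs gs.
- move=> x; apply: (@continuous_comp (weak_star A) (weak_star B)
    (weak_star C) f g); [exact: fn | exact: gn].
Qed.

Let wstar_hom_eq A B (f g : wstar_hom A B) : sval f = sval g -> f = g.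
Proof. by case: f g => [f fP] [g gP] /= fg; exact: eq_exist. Qed.

Let wid A : wstar_hom A A := exist _ id (id_normal A).

Let wcomp A B C (f : wstar_hom A B) (g : wstar_hom B C) : wstar_hom A C :=
  exist _ (sval g \o sval f) (comp_normal f g).

Let wcomp_idl A B (f : wstar_hom A B) : wcomp (wid A) f = f.
Proof. exact: wstar_hom_eq. Qed.

Let wcomp_idr A B (f : wstar_hom A B) : wcomp f (wid B) = f.
Proof. exact: wstar_hom_eq. Qed.

Let wcomp_assoc A B C D (f : wstar_hom A B) (g : wstar_hom B C)
  (h : wstar_hom C D) : wcomp f (wcomp g h) = wcomp (wcomp f g) h.
Proof. exact: wstar_hom_eq. Qed.

Definition wstar_category : category (wstarAlg R) :=
  Category wcomp_idl wcomp_idr wcomp_assoc.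
End wstar_category.

(* Main.v *)
From HB Require Import structures.
Require Import Defs.
From mathcomp Require Import all_boot all_order all_algebra.
From mathcomp Require Import complex.
From mathcomp Require Import all_classical all_reals all_analysis.
From Stdlib Require Import Relation_Definitions.
From Stdlib Require List.

(* Fix a cardinal [K] and a set [X] so large that the ideal of "thin" subsets,
   which contains the finite sets and is stable under unions of [K] many
   members, is proper. The algebras [linf (X \ S)], [S] thin, with restriction
   maps form a [K]-directed diagram whose colimit is the zero algebra: finite
   indicators tend weakly-star to [1] and every finite set is eventually
   removed, so [1 = 0] in the apex of any cocone. If [c] is [K]-presentable and
   [chi0], [chi1] are normal characters of [c], then the maps from [c] to
   [linf X] that are [chi0] (resp. [chi1]) at each point are equalized by the
   colimit, hence already on some nonempty [X \ S], so [chi0 = chi1]. Thus maps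
   from presentable objects do not separate the two characters of [C^2], which
   is therefore not a colimit of presentable objects. *)

Set Implicit Arguments.
Unset Strict Implicit.
Unset Printing Implicit Defensive.

Import Order.TTheory GRing.Theory Num.Theory.
Import numFieldNormedType.Exports.

Local Open Scope classical_set_scope.
Local Open Scope card_scope.
Local Open Scope complex_scope.
Local Open Scope ring_scope.

(** * Spaces of bounded functions under the sup norm *)

Section sup_norm.
Context (R : realType).
Implicit Types (M e : R[i]).

Lemma ReK M : 0 <= M -> (complex.Re M)%:C = M.
Proof. by move=> M0; apply: RRe_real; exact: ger0_real. Qed.

Lemma le_Re M N : 0 <= M -> M <= N -> complex.Re M <= complex.Re N.
Proof. by move=> M0 MN; rewrite -lecR !ReK// (le_trans M0). Qed.

(** The order of [R[i]] is partial: the instance [e = 1] forces equal imaginary parts, after which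
    the real statement applies. *)
Lemma ler_addgt0P M N : (forall e, 0 < e -> M <= N + e) -> M <= N.
Proof.
move=> MN; have := MN 1 ltr01; rewrite lecE => /andP[/eqP im _].
have im' : complex.Im M = complex.Im N.
  by move: im; case: (N) => a b /=; rewrite addr0.
rewrite lecE im' eqxx /=; apply/ler_addgt0Pr => e e0.
have := MN e%:C; rewrite ltcR => /(_ e0); rewrite lecE => /andP[_].
by case: (N).
Qed.

Lemma eq_small M N : (forall e, 0 < e -> `|M - N| <= e) -> M = N.
Proof.
move=> MN; apply/eqP; rewrite -subr_eq0 -normr_le0.
by apply: ler_addgt0P => e e0; rewrite add0r MN.
Qed.

Lemma normc_ge_Im (x : R[i]) : `|complex.Im x|%:C <= `|x|.
Proof.
by case: x => a b; rewrite normc_def lecR -sqrtr_sqr ler_wsqrtr// lerDr sqr_ge0.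
Qed.

Lemma normc_le_ReIm (x : R[i]) :
  `|x| <= (`|complex.Re x| + `|complex.Im x|)%:C.
Proof.
rewrite normc_def lecR -(@ger0_norm _ (`|_| + _)) ?addr_ge0// -sqrtr_sqr.
rewrite ler_wsqrtr// sqrrD !real_normK ?num_real// lerD2r lerDl.
by rewrite mulrn_wge0// mulr_ge0.
Qed.

Section sup.
Context (T : Type) (D : set T) (f : T -> R[i]) (B : R[i]).
Hypothesis fB : forall t, D t -> `|f t| <= B.
Let s := sup [set complex.Re `|f t| | t in D].

Lemma le_sup_norm t : D t -> `|f t| <= s%:C.
Proof.
move=> Dt; rewrite -(ReK (normr_ge0 (f t))) lecR.
apply: sup_upper_bound; last by exists t.
split; first by exists (complex.Re `|f t|); exists t.
by exists (complex.Re B) => _ [u Du <-]; apply: le_Re => //; exact: fB.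
Qed.

Lemma sup_norm_le : D !=set0 -> s%:C <= B.
Proof.
move=> [t Dt]; have B0 : 0 <= B := le_trans (normr_ge0 _) (fB Dt).
rewrite -(ReK B0) lecR; apply: ge_sup.
  by exists (complex.Re `|f t|); exists t.
by move=> _ [u Du <-]; apply: le_Re => //; exact: fB.
Qed.
End sup.
End sup_norm.

(** Both [linf X] and its predual are instances, so that norm and completeness are set up only once;
    [in_space_closed] is what yields completeness. *)
Record function_space (R : realType) (Z : Type) := FunctionSpace {
  in_space : set (Z -> R[i]);
  in_space0 : in_space (fun=> 0);
  in_space_linear : forall k f g, in_space f -> in_space g ->
    in_space (fun z => k * f z + g z);
  in_space_bounded : forall f, in_space f -> exists M, forall z, `|f z| <= M;
  in_space_closed : forall f, (forall e : R[i], 0 < e ->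
    exists2 g, in_space g & forall z, `|f z - g z| <= e) -> in_space f
}.

Record space_elt (R : realType) (Z : Type) (S : function_space R Z) :=
  SpaceElt { space_fun :> Z -> R[i]; space_funP : in_space S space_fun }.

Section space_normed.
Context (R : realType) (Z : Type) (S : function_space R Z).
Implicit Types (f g : space_elt S) (k : R[i]).

Lemma space_eq f g : f =1 g -> f = g.
Proof.
case: f g => [f fP] [g gP] /= /funext fg; case: _ / fg gP => gP.
by congr SpaceElt; exact: Prop_irrelevance.
Qed.

Let zero : space_elt S := SpaceElt (in_space0 S).

Let lin k f g : space_elt S :=
  SpaceElt (in_space_linear k (space_funP f) (space_funP g)).

HB.instance Definition _ := gen_eqMixin (space_elt S).
HB.instance Definition _ := gen_choiceMixin (space_elt S).

Let add f g := lin 1 f g.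
Let opp f := lin (-1) f zero.
Let scale k f := lin k f zero.

Let addE f g z : add f g z = f z + g z. Proof. by rewrite /= mul1r. Qed.
Let oppE f z : opp f z = - f z. Proof. by rewrite /= addr0 mulN1r. Qed.
Let scaleE k f z : scale k f z = k * f z. Proof. by rewrite /= addr0. Qed.

Let addA : associative add.
Proof. by move=> f g h; apply: space_eq => z; rewrite !addE addrA. Qed.
Let addC : commutative add.
Proof. by move=> f g; apply: space_eq => z; rewrite !addE addrC. Qed.
Let add0 : left_id zero add.
Proof. by move=> f; apply: space_eq => z; rewrite addE add0r. Qed.
Let addN : left_inverse zero opp add.
Proof. by move=> f; apply: space_eq => z; rewrite addE oppE addNr. Qed.

HB.instance Definition _ := GRing.isZmodule.Build (space_elt S)
  addA addC add0 addN.

Let scaleA a b f : scale a (scale b f) = scale (a * b) f.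
Proof. by apply: space_eq => z; rewrite !scaleE mulrA. Qed.
Let scale1 : left_id 1 scale.
Proof. by move=> f; apply: space_eq => z; rewrite !scaleE mul1r. Qed.
Let scaleDr : right_distributive scale +%R.
Proof.
by move=> k f g; apply: space_eq => z; rewrite scaleE !addE !scaleE mulrDr.
Qed.
Let scaleDl f : {morph scale^~ f : a b / a + b}.
Proof.
by move=> a b; apply: space_eq => z; rewrite scaleE addE !scaleE mulrDl.
Qed.

HB.instance Definition _ := GRing.Zmodule_isLmodule.Build R[i] (space_elt S)
  scaleA scale1 scaleDr scaleDl.

Lemma spaceD f g z : (f + g) z = f z + g z. Proof. exact: addE. Qed.
Lemma spaceN f z : (- f) z = - f z. Proof. exact: oppE. Qed.
Lemma spaceB f g z : (f - g) z = f z - g z. Proof. by rewrite spaceD spaceN. Qed.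
Lemma spaceZ k f z : (k *: f) z = k * f z. Proof. exact: scaleE. Qed.
Lemma space0 z : (0 : space_elt S) z = 0. Proof. by []. Qed.

(* [0] is added to the set so that the norm is also right when [Z] is empty. *)
Let nrm f : R[i] := (sup [set complex.Re `|w| | w in 0 |` range f])%:C.

Let nrm_bounded f : exists B, forall w, (0 |` range f) w -> `|w| <= B.
Proof.
have [M fM] := in_space_bounded (space_funP f); exists `|M| => w [->|[z _ <-]].
  by rewrite normr0.
by rewrite (le_trans (fM z))// real_ler_norm// (ger0_real (le_trans _ (fM z))).
Qed.

Let nrm_ge f z : `|f z| <= nrm f.
Proof.
by have [B fB] := nrm_bounded f; apply: (le_sup_norm fB); right; exists z.
Qed.

Let nrm_le f M : 0 <= M -> (forall z, `|f z| <= M) -> nrm f <= M.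
Proof.
move=> M0 fM; apply: (@sup_norm_le _ _ _ id); last by exists 0; left.
by move=> w [->|[z _ <-]]; rewrite ?normr0.
Qed.

Let nrm_ge0 f : 0 <= nrm f.
Proof.
have [B fB] := nrm_bounded f.
have : `|0 : R[i]| <= nrm f by apply: (@le_sup_norm _ _ _ id _ fB); left.
by rewrite normr0.
Qed.

Let nrmD f g : nrm (f + g) <= nrm f + nrm g.
Proof.
apply: nrm_le => [|z]; first by rewrite addr_ge0.
by rewrite spaceD (le_trans (ler_normD _ _))// lerD.
Qed.

Let nrmZ_le k f : nrm (k *: f) <= `|k| * nrm f.
Proof.
apply: nrm_le => [|z]; first by rewrite mulr_ge0.
by rewrite spaceZ normrM ler_wpM2l.
Qed.

Let nrmZ k f : nrm (k *: f) = `|k| * nrm f.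
Proof.
apply/le_anti/andP; split; first exact: nrmZ_le.
have [->|k0] := eqVneq k 0; first by rewrite normr0 mul0r.
rewrite -ler_pdivlMl ?normr_gt0// -normfV.
by apply: le_trans (nrmZ_le _ _); rewrite scalerA mulVf// scale1r.
Qed.

Let nrm0_eq0 f : nrm f = 0 -> f = 0.
Proof.
move=> f0; apply: space_eq => z; apply/eqP; rewrite space0 -normr_le0 -f0.
exact: nrm_ge.
Qed.

HB.instance Definition _ := Lmodule_isNormed.Build R[i] (space_elt S)
  nrmD nrmZ nrm0_eq0.

Lemma space_norm_ge f z : `|f z| <= `|f|. Proof. exact: nrm_ge. Qed.

Lemma space_norm_le f M : 0 <= M -> (forall z, `|f z| <= M) -> `|f| <= M.
Proof. exact: nrm_le. Qed.

Section complete.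
Variable F : set_system (space_elt S).
Hypothesis FF : ProperFilter F.
Hypothesis Fcauchy : cauchy F.

Let Fsmall (e : R[i]) : 0 < e -> exists2 A, F A &
  forall f g z, A f -> A g -> `|f z - g z| <= e.
Proof.
move=> e0; have e20 : 0 < e / 2 by rewrite divr_gt0.
have [f Ff] := (cauchyP F).1 Fcauchy _ e20.
exists (ball f (e / 2)) => // g h z; rewrite -!ball_normE /= => fg fh.
rewrite -spaceB (le_trans (space_norm_ge _ _))//.
rewrite [e]splitr (le_trans (ler_distD f _ _))// lerD//.
  by rewrite distrC ltW.
by rewrite ltW.
Qed.

(** Here [p] is the real or the imaginary part, so that pointwise limits come from the completeness
    of [R]. *)
Let cvg_part (p : R[i] -> R) :
  (forall a b, `|p a - p b|%:C <= `|a - b|) -> forall z,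
  cvg ((fun f : space_elt S => p (f z)) @ F).
Proof.
move=> plip z; apply: R_complete; apply/cauchyP => e e0.
have [|A FA Ae] := @Fsmall (e / 2)%:C; first by rewrite ltcR divr_gt0.
have [f Af] := filter_ex FA; exists (p (f z)); apply: (@filterS _ F _ A) => // g Ag.
rewrite -ball_normE /= (@le_lt_trans _ _ (e / 2))// ?gtr_pMr ?invf_lt1 ?ltr1n//.
by rewrite -lecR (le_trans (plip _ _))// Ae.
Qed.

Let Re_lip (a b : R[i]) : `|complex.Re a - complex.Re b|%:C <= `|a - b|.
Proof. by have := normc_ge_Re (a - b); case: a b => [? ?] [? ?]. Qed.

Let Im_lip (a b : R[i]) : `|complex.Im a - complex.Im b|%:C <= `|a - b|.
Proof. by have := normc_ge_Im (a - b); case: a b => [? ?] [? ?]. Qed.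

Let l z : R[i] := (lim ((fun f : space_elt S => complex.Re (f z)) @ F) +i*
  lim ((fun f : space_elt S => complex.Im (f z)) @ F))%C.

Let l_near z (e : R[i]) : 0 < e ->
  \forall f \near F, `|l z - (f : space_elt S) z| <= e.
Proof.
move=> e0; have e20 : 0 < complex.Re e / 2.
  by rewrite divr_gt0//; move: e0; rewrite ltcE => /andP[].
have /cvgrPdist_le /(_ _ e20) Fr := @cvg_part _ Re_lip z.
have /cvgrPdist_le /(_ _ e20) Fi := @cvg_part _ Im_lip z.
near=> f.
have r : `|complex.Re (l z - f z)| <= complex.Re e / 2.
  rewrite (_ : complex.Re _ = complex.Re (l z) - complex.Re (f z)).
    by near: f.
  by case: (f z).
have i : `|complex.Im (l z - f z)| <= complex.Re e / 2.
  rewrite (_ : complex.Im _ = complex.Im (l z) - complex.Im (f z)).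
    by near: f.
  by case: (f z).
rewrite (le_trans (normc_le_ReIm _))// -(ReK (ltW e0)) lecR.
by rewrite [leRHS]splitr lerD.
Unshelve. all: by end_near. Qed.

(** At each [z] the limit is compared with [f z] through some [g] of the same Cauchy set [A]; since
    [A] does not depend on [z], the convergence is uniform. *)
Let l_unif (e : R[i]) : 0 < e -> exists2 A, F A &
  forall f z, A f -> `|l z - f z| <= e.
Proof.
move=> e0; have e20 : 0 < e / 2 by rewrite divr_gt0.
have [A FA Ae] := Fsmall e20; exists A => // f z Af.
have [g [Ag lg]] := filter_ex (filterI FA (l_near z e20)).
by rewrite (le_trans (ler_distD (g z) _ _))// [e]splitr lerD// Ae.
Qed.

Let l_in : in_space S l.
Proof.
apply: in_space_closed => e /l_unif[A FA Ae].
have [f Af] := filter_ex FA; exists f; first exact: space_funP.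
by move=> z; exact: Ae.
Qed.

Lemma space_complete : cvg F.
Proof.
apply/cvg_ex; exists (SpaceElt l_in); apply/cvgrPdist_le => e e0.
have [A FA Ae] := l_unif e0; apply: filterS FA => f Af.
by apply: space_norm_le => [|z]; [exact: ltW | rewrite spaceB Ae].
Qed.
End complete.

HB.instance Definition _ := Uniform_isComplete.Build (space_elt S) space_complete.

End space_normed.

(** * The C*-algebra of bounded functions on a set *)

Section bounded_functions.
Context (R : realType) (X : Type).

Let bounded : set (X -> R[i]) := [set f | exists M, forall x, `|f x| <= M].

Let bounded0 : bounded (fun=> 0).
Proof. by exists 0 => x; rewrite normr0. Qed.

Let bounded_linear k f g : bounded f -> bounded g ->
  bounded (fun x => k * f x + g x).
Proof.
move=> [M fM] [N gN]; exists (`|k| * M + N) => x.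
by rewrite (le_trans (ler_normD _ _))// lerD// normrM ler_wpM2l.
Qed.

Let bounded_closed f : (forall e : R[i], 0 < e ->
  exists2 g, bounded g & forall x, `|f x - g x| <= e) -> bounded f.
Proof.
move=> /(_ 1 ltr01)[g [M gM] fg]; exists (1 + M) => x.
by rewrite -[f x](subrK (g x)) (le_trans (ler_normD _ _))// lerD.
Qed.

Definition linf_space : function_space R X :=
  FunctionSpace bounded0 bounded_linear (fun _ => id) bounded_closed.

Local Notation linf := (space_elt linf_space).
Implicit Types f g h : linf.

Definition mk_linf (f : X -> R[i]) M (fM : forall x, `|f x| <= M) : linf :=
  @SpaceElt _ _ linf_space f (ex_intro _ M fM).

Let one_subproof (x : X) : `|1 : R[i]| <= 1.
Proof. by rewrite normr1. Qed.

Let one : linf := mk_linf one_subproof.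

Let mul_subproof f g x : `|f x * g x| <= `|f| * `|g|.
Proof. by rewrite normrM ler_pM// space_norm_ge. Qed.

Let mul f g : linf := mk_linf (mul_subproof f g).

Let star_subproof f x : `|(f x)^*%C| <= `|f|.
Proof. by rewrite normcJ space_norm_ge. Qed.

Let star f : linf := mk_linf (star_subproof f).

Let mulE f g x : mul f g x = f x * g x. Proof. by []. Qed.
Let starE f x : star f x = (f x)^*%C. Proof. by []. Qed.

Let mulA : associative mul.
Proof. by move=> f g h; apply: space_eq => x; rewrite !mulE mulrA. Qed.
Let mul1l : left_id one mul.
Proof. by move=> f; apply: space_eq => x; rewrite mulE mul1r. Qed.
Let mul1r : right_id one mul.
Proof. by move=> f; apply: space_eq => x; rewrite mulE mulr1. Qed.
Let mulDl : left_distributive mul +%R.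
Proof.
by move=> f g h; apply: space_eq => x; rewrite spaceD !mulE spaceD mulrDl.
Qed.
Let mulDr : right_distributive mul +%R.
Proof.
by move=> f g h; apply: space_eq => x; rewrite spaceD !mulE spaceD mulrDr.
Qed.
Let scaleAl (k : R[i]) f g : k *: mul f g = mul (k *: f) g.
Proof. by apply: space_eq => x; rewrite spaceZ !mulE spaceZ mulrA. Qed.
Let scaleAr (k : R[i]) f g : k *: mul f g = mul f (k *: g).
Proof. by apply: space_eq => x; rewrite spaceZ !mulE spaceZ mulrCA. Qed.
Let normM f g : `|mul f g| <= `|f| * `|g|.
Proof.
apply: space_norm_le; first by rewrite mulr_ge0.
exact: mul_subproof.
Qed.
Let starK : involutive star.
Proof. by move=> f; apply: space_eq => x; rewrite !starE conjcK. Qed.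
Let star_linear (k : R[i]) f g : star (k *: f + g) = (k^*)%C *: star f + star g.
Proof.
by apply: space_eq => x; rewrite spaceD spaceZ !starE spaceD spaceZ rmorphD rmorphM.
Qed.
Let starM f g : star (mul f g) = mul (star g) (star f).
Proof. by apply: space_eq => x; rewrite mulE !starE mulE rmorphM mulrC. Qed.
Let star_identity f : `|mul (star f) f| = `|f| ^+ 2.
Proof.
apply/le_anti/andP; split.
  rewrite (le_trans (normM _ _))// expr2 ler_wpM2r//.
  by apply: space_norm_le => // x; exact: star_subproof.
(* Taking square roots reduces the bound on the norm of [f] to a pointwise one, which squares back
   to the value of [star f * f] at [x]. *)
rewrite -[leRHS]sqrtCK ler_pXn2r ?nnegrE ?sqrtC_ge0//.
apply: space_norm_le => [|x]; first by rewrite sqrtC_ge0.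
rewrite -(@ler_pXn2r _ 2) ?nnegrE ?sqrtC_ge0// sqrtCK.
by rewrite (le_trans _ (space_norm_ge _ x))// mulE starE normrM normcJ expr2.
Qed.

HB.instance Definition _ := isCStarAlgebra.Build R linf mulA mul1l mul1r
  mulDl mulDr scaleAl scaleAr normM starK star_linear starM star_identity.
End bounded_functions.

(** * Duality *)

Section predual.
Context (R : realType).
Implicit Types X Y : Type.

(* The predual of [linf X], that is l^1(X), is realized as the uniform closure
   of the span of the point evaluations in the space of bounded functions on the
   unit ball [disc_fun X] of [linf X]; this avoids unordered sums. A finite
   combination of point evaluations is given by the list [s] in [comb s]. *)
Record disc_fun X := DiscFun {
  disc_val :> X -> R[i];
  disc_valP : forall x, `|disc_val x| <= 1 }.

Definition comb X (s : seq (R[i] * X)) (f : X -> R[i]) : R[i] :=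
  \sum_(p <- s) p.1 * f p.2.

(** The bound is the l^1 norm of the coefficients. *)
Lemma comb_bounded X s : exists2 M, 0 <= M &
  forall (f : X -> R[i]) N, 0 <= N -> (forall x, `|f x| <= N) ->
    `|comb s f| <= M * N.
Proof.
exists (\sum_(p <- s) `|p.1|) => [|f N N0 fN]; first by rewrite sumr_ge0.
rewrite /comb mulr_suml (le_trans (ler_norm_sum _ _ _))// ler_sum// => p _.
by rewrite normrM ler_wpM2l.
Qed.

Lemma combZ X s (k : R[i]) (f : X -> R[i]) :
  comb s (fun x => k * f x) = k * comb s f.
Proof. by rewrite /comb mulr_sumr; apply: eq_bigr => p _; rewrite mulrCA. Qed.

Lemma combD X s (f g : X -> R[i]) :
  comb s (fun x => f x + g x) = comb s f + comb s g.
Proof. by rewrite /comb -big_split /=; apply: eq_bigr => p _; rewrite mulrDr. Qed.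

Definition approx X (v : disc_fun X -> R[i]) (e : R[i]) s :=
  forall b : disc_fun X, `|v b - comb s b| <= e.

Let in_predual X : set (disc_fun X -> R[i]) :=
  [set v | forall e : R[i], 0 < e -> exists s, approx v e s].

Let in_predual0 X : @in_predual X (fun=> 0).
Proof.
by move=> e e0; exists [::] => b; rewrite /comb big_nil subr0 normr0 ltW.
Qed.

Let in_predual_linear X k v w : @in_predual X v -> in_predual w ->
  in_predual (fun b => k * v b + w b).
Proof.
move=> vP wP e e0; have k0 : 0 < `|k| + 1 by rewrite ltr_pwDr.
have [s vs] := vP _ (divr_gt0 e0 k0); have [t wt] := wP _ (divr_gt0 e0 k0).
exists ([seq (k * p.1, p.2) | p <- s] ++ t) => b.
rewrite /comb big_cat big_map /=.
under eq_bigr do rewrite -mulrA.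
rewrite -mulr_sumr opprD addrACA -mulrBr (le_trans (ler_normD _ _))//.
have -> : e = `|k| * (e / (`|k| + 1)) + e / (`|k| + 1).
  by rewrite -{2}[e / _]mul1r -mulrDl mulrC divfK// gt_eqF.
by rewrite lerD ?normrM ?ler_wpM2l ?vs ?wt.
Qed.

Let in_predual_bounded X v : @in_predual X v -> exists M, forall b, `|v b| <= M.
Proof.
move=> /(_ 1 ltr01)[s vs]; have [M M0 sM] := comb_bounded s.
exists (1 + M * 1) => b; rewrite -[v b](subrK (comb s b)).
by rewrite (le_trans (ler_normD _ _))// lerD// sM//; exact: disc_valP.
Qed.

Let in_predual_closed X v : (forall e : R[i], 0 < e ->
  exists2 w, @in_predual X w & forall b, `|v b - w b| <= e) -> in_predual v.
Proof.
move=> vP e e0; have e20 : 0 < e / 2 by rewrite divr_gt0.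
have [w wP vw] := vP _ e20; have [s ws] := wP _ e20.
by exists s => b; rewrite [e]splitr (le_trans (ler_distD (w b) _ _))// lerD.
Qed.

Definition predual_space X : function_space R (disc_fun X) :=
  FunctionSpace (@in_predual0 X) (@in_predual_linear X) (@in_predual_bounded X)
    (@in_predual_closed X).

Local Notation linf X := (space_elt (linf_space R X)).
Local Notation pre X := (space_elt (predual_space X)).

Lemma predual_approx X (v : pre X) (e : R[i]) : 0 < e -> exists s, approx v e s.
Proof. exact: (space_funP v). Qed.

Section evaluation.
Context (X : Type).
Implicit Types (a : linf X) (v : pre X) (M : R[i]).

Let norm1_gt0 a : 0 < `|a| + 1. Proof. by rewrite ltr_pwDr. Qed.

Let shrink_subproof a M : `|a| <= M -> forall x, `|a x / M| <= 1.
Proof.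
rewrite le_eqVlt => /predU1P[<- x|aM x].
  (* The case [M = 0] is harmless because the inverse of [0] is [0]. *)
  have [a0|a0] := eqVneq `|a| 0; first by rewrite a0 invr0 mulr0 normr0.
  by rewrite normrM normfV normr_id ler_pdivrMr ?mul1r ?space_norm_ge// lt_def a0/=.
have M0 : 0 < M by rewrite (le_lt_trans _ aM).
rewrite normrM normfV (gtr0_norm M0) ler_pdivrMr// mul1r.
by rewrite (le_trans (space_norm_ge _ _))// ltW.
Qed.

Let shrink a M (aM : `|a| <= M) : disc_fun X := DiscFun (shrink_subproof aM).

Let le_norm1 a : `|a| <= `|a| + 1. Proof. by rewrite lerDl. Qed.

(** As [v] is only defined on the unit ball, [a] is scaled into it and the factor is restored; the
    summand [1] keeps the factor nonzero. *)
Definition pairing a v : R[i] := (`|a| + 1) * v (shrink (le_norm1 a)).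

Lemma pairing_approx a v e s : approx v e s ->
  `|pairing a v - comb s a| <= (`|a| + 1) * e.
Proof.
move=> vs.
have -> : comb s a = (`|a| + 1) * comb s (shrink (le_norm1 a)).
  rewrite -combZ; congr comb; apply/funext => x /=.
  by rewrite mulrC divfK// gt_eqF.
by rewrite -mulrBr normrM (gtr0_norm (norm1_gt0 a)) ler_wpM2l// ltW.
Qed.

(** The pairing is the limit of the finite sums [comb s a], so identities between pairings can be
    checked on such sums. *)
Lemma pairing_unique a v c K : 0 <= K ->
  (forall e s, 0 < e -> approx v e s -> `|c - comb s a| <= K * e) ->
  c = pairing a v.
Proof.
move=> K0 cP; apply: eq_small => e e0.
have N0 : 0 < K + (`|a| + 1) by rewrite ltr_wpDl.
have [s vs] := predual_approx v (divr_gt0 e0 N0).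
rewrite (le_trans (ler_distD (comb s a) _ _))//.
have := lerD (cP _ _ (divr_gt0 e0 N0) vs) (pairing_approx a vs).
by rewrite -mulrDl mulrC divfK ?gt_eqF// (distrC (pairing a v)).
Qed.

Lemma pairing_linearl k a b v :
  pairing (k *: a + b) v = k * pairing a v + pairing b v.
Proof.
apply/esym/(@pairing_unique _ _ _ (`|k| * (`|a| + 1) + (`|b| + 1))).
  by rewrite addr_ge0 ?mulr_ge0 ?addr_ge0.
move=> e s e0 vs.
have -> : comb s (k *: a + b) = k * comb s a + comb s b.
  by rewrite -combZ -combD; congr comb; apply/funext => x; rewrite spaceD spaceZ.
rewrite opprD addrACA -mulrBr mulrDl -mulrA (le_trans (ler_normD _ _))// normrM.
by rewrite lerD ?ler_wpM2l// pairing_approx.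
Qed.

Lemma pairing_le a v : `|pairing a v| <= `|a| * `|v|.
Proof.
have [a0|a0] := eqVneq `|a| 0.
  have /esym -> : 0 = pairing a v; last by rewrite normr0 a0 mul0r.
  apply: (@pairing_unique _ _ _ 0) => // e s e0 vs.
  rewrite (_ : comb s a = 0) ?subrr ?normr0 ?mul0r// /comb big1// => p _.
  by rewrite (normr0_eq0 a0) mulr0.
(* The sharp bound needs the scaling factor [|a|] itself instead of [|a| + 1]; both give the same
   pairing. *)
rewrite -(@pairing_unique _ _ (`|a| * v (shrink (lexx `|a|))) `|a|)//.
  by rewrite normrM normr_id ler_wpM2l// space_norm_ge.
move=> e s e0 vs.
have -> : comb s a = `|a| * comb s (shrink (lexx `|a|)).
  by rewrite -combZ; congr comb; apply/funext => x /=; rewrite mulrC divfK.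
by rewrite -mulrBr normrM normr_id ler_wpM2l.
Qed.

Let pairing_linearr a : linear (pairing a : pre X -> R[i]^o).
Proof.
by move=> k v w; rewrite /pairing spaceD spaceZ mulrDr mulrCA.
Qed.

HB.instance Definition _ a :=
  GRing.isLinear.Build R[i] (pre X) R[i]^o _ (pairing a) (pairing_linearr a).

Definition linf_ev a : {linear pre X -> R[i]^o} := pairing a.

Let delta_subproof x : in_predual (fun b : disc_fun X => b x).
Proof.
move=> e e0; exists [:: (1, x)] => b.
by rewrite /comb big_seq1 mul1r subrr normr0 ltW.
Qed.

Definition delta x : pre X :=
  @SpaceElt _ _ (predual_space X) _ (@delta_subproof x).

Lemma pairing_delta a x : pairing a (delta x) = a x.
Proof. by rewrite /pairing /= mulrC divfK// gt_eqF. Qed.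

Lemma norm_delta x : `|delta x| <= 1.
Proof. by apply: space_norm_le => // b; exact: disc_valP. Qed.

Lemma approx_delta v (e : R[i]) s : 0 <= e -> approx v e s ->
  `|v - \sum_(p <- s) p.1 *: delta p.2| <= e.
Proof.
move=> e0 vs; apply: space_norm_le => // b.
suff sE : (\sum_(p <- s) p.1 *: delta p.2) b = comb s b by rewrite spaceB sE.
rewrite /comb; elim: s {vs} => [|p s IH]; first by rewrite !big_nil.
by rewrite !big_cons spaceD spaceZ IH.
Qed.

(** Isometry: [pairing_le] bounds the dual norm by [|a|], and the elements [delta x] of the unit
    ball recover the values of [a]. Surjectivity: the values of [f] on the [delta x] form a bounded
    function, which determines [f] because their span is dense by [approx_delta]. *)
Lemma linf_dual : is_dual_of linf_ev.
Proof.
have cont a : continuous (linf_ev a).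
  apply: bounded_linear_continuous; apply/linear_boundedP.
  apply: filterS (nbhs_pinfty_ge (normr_real a)) => r ar v.
  by rewrite (le_trans (pairing_le _ _))// ler_wpM2r.
split => [//|||f fcont].
- exact: pairing_linearl.
- move=> a.
  have le1 v : [set v : pre X | `|v| <= 1] v -> `|linf_ev a v| <= `|a|.
    by move=> v1; rewrite (le_trans (pairing_le _ _))// ler_piMr.
  apply/le_anti/andP; split; last first.
    by apply: sup_norm_le le1 _; exists 0 => /=; rewrite normr0.
  apply: space_norm_le => [|x].
    have := le_sup_norm le1 (t := 0); rewrite /= normr0.
    by move=> /(_ ler01); rewrite linear0 normr0.
  by rewrite -pairing_delta; apply: (le_sup_norm le1); exact: norm_delta.
- have /linear_boundedP/pinfty_ex_gt0[C C0 fC] : bounded_near f (nbhs 0).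
    exact/linear_bounded_continuous.
  have aC x : `|f (delta x)| <= C.
    by rewrite (le_trans (fC _))// ler_piMr ?norm_delta// ltW.
  exists (mk_linf aC) => v; apply/esym/(@pairing_unique _ _ _ C).
    exact: ltW.
  move=> e s e0 vs.
  have -> : comb s (mk_linf aC) = f (\sum_(p <- s) p.1 *: delta p.2).
    by rewrite raddf_sum; apply: eq_bigr => p _; rewrite /= linearZ.
  by rewrite -raddfB (le_trans (fC _))// ler_wpM2l ?approx_delta// ltW.
Qed.

Definition linf_wstar : wstarAlg R := 
  @WStarAlg R (linf X) (CStarAlgebra.class (linf X : cstarAlgType R)) (pre X)
    linf_ev linf_dual.
End evaluation.

(** * Pullback along a map of sets and its preadjoint *)

Section pullback.
Context (X Y : Type) (g : Y -> X).

Let push_subproof (v : pre Y) :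
  in_predual (fun b : disc_fun X => v (DiscFun (fun y => disc_valP b (g y)))).
Proof.
move=> e e0; have [s vs] := predual_approx v e0.
exists [seq (p.1, g p.2) | p <- s] => b; rewrite /comb big_map.
exact: vs.
Qed.

(** In terms of l^1, the coefficients are summed over the fibres of [g]. *)
Definition push (v : pre Y) : pre X :=
  @SpaceElt _ _ (predual_space X) _ (push_subproof v).

Definition pull (a : linf X) : linf Y :=
  mk_linf (fun y => space_norm_ge a (g y)).

Lemma pairing_pull a v : pairing (pull a) v = pairing a (push v).
Proof.
apply/esym/(@pairing_unique _ _ _ _ (`|a| + 1)); first by rewrite addr_ge0.
move=> e s e0 vs.
rewrite (_ : comb s (pull a) = comb [seq (p.1, g p.2) | p <- s] a).
  by apply: pairing_approx => b; rewrite /comb big_map; exact: vs.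
by rewrite /comb big_map.
Qed.
End pullback.
End predual.

Notation linf X := (space_elt (linf_space _ X)).

(** * The weak-star topology *)

Section weak_star.
Context (R : realType).
Implicit Types A B : wstarAlg R.

Lemma weak_star_ev_continuous A (v : predual A) :
  continuous (fun a : weak_star A => ev (a : cstar_of A) v : R[i]^o).
Proof.
move=> a.
have evc : {for a, continuous
    (fun a : weak_star A => ev (a : cstar_of A) : {ptws predual A -> R[i]^o})}.
  exact: initial_continuous.
exact: (continuous_comp evc (@proj_continuous _ (fun=> R[i]^o) v _)).
Qed.

Lemma weak_star_cvg A (F : set_system (cstar_of A)) (a : cstar_of A) :
  Filter F ->
  (forall v : predual A, (fun b => ev b v : R[i]^o) @ F --> ev a v) ->
  F --> (a : weak_star A).
Proof.
move=> FF Fv.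
have : (fun b : cstar_of A => ev b : {ptws predual A -> R[i]^o}) @ F
    --> (ev a : {ptws predual A -> R[i]^o}).
  by apply/pointwise_cvgP => v; exact: Fv.
move=> evF U [B [[W oW <-]] /= Wa /filterS]; apply.
apply: evF; exact: open_nbhs_nbhs.
Qed.

(** The norm of [a - b] is the dual norm of a functional that vanishes everywhere. *)
Lemma weak_star_hausdorff A (a b : cstar_of A) :
  (forall v, ev a v = ev b v) -> a = b.
Proof.
move=> ab; have [_ el ei _] := ev_is_dual A.
apply: subr0_eq; apply: normr0_eq0; rewrite ei /dual_norm.
rewrite (_ : [set _ | _ in _] = [set 0]) ?sup1//.
have ab0 v : ev (a - b) v = 0.
  by rewrite addrC -scaleN1r el ab mulN1r addNr.
apply/seteqP; split=> [_ [v _ <-]|_ ->]; first by rewrite ab0 normr0.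
by exists 0; [rewrite /mkset normr0 | rewrite ab0 normr0].
Qed.
Lemma zero_wstar (A : wstarAlg R) :
  (cone : cstar_of A) = 0 -> forall m n : cstar_of A, m = n.
Proof.
move=> one0; suff m0 m : m = 0 :> cstar_of A 
  by move=> m n; rewrite (m0 m) (m0 n).
by rewrite -[LHS]cmul1l one0 -[X in cmul X _](scale0r cone) -cscaleAl !scale0r.
Qed.
End weak_star.

(** * Functoriality of [linf] and weak-star limits of finite indicators *)

Section linf_functor.
Context (R : realType).
Let W X := linf_wstar R X.

(** Normality holds because testing [pull g] against [v] is testing against [push g v]. *)
Lemma pull_normal X Y (g : Y -> X) :
  @is_normal_star_hom R (W X) (W Y) (pull g).
Proof.
split.
- by move=> k a b; apply: space_eq => y.
- by move=> a b; apply: space_eq => y.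
- by apply: space_eq => y.
- by move=> a; apply: space_eq => y.
- move=> a.
  apply: (@weak_star_cvg R (W Y) (pull g @ nbhs (a : weak_star (W X)))) => v.
  have := @weak_star_ev_continuous R (W X) (push g v) a.
  by under eq_fun do rewrite /= -pairing_pull.
Qed.

Definition pull_hom X Y (g : Y -> X) : wstar_hom (W X) (W Y) :=
  exist _ _ (pull_normal g).

Lemma wstar_hom_eq (A B : wstarAlg R) (f g : wstar_hom A B) :
  sval f =1 sval g -> f = g.
Proof. by case: f g => [f fP] [g gP] /= /funext fg; exact: eq_exist. Qed.

Lemma pull_hom_ext X Y (g h : Y -> X) : g =1 h -> pull_hom g = pull_hom h.
Proof. by move=> /funext ->. Qed.

Lemma pull_hom_id X : pull_hom id = idc (wstar_category R) (W X).
Proof. by apply: wstar_hom_eq => a; exact: space_eq. Qed.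

Lemma pull_hom_comp X Y Z (g : Y -> X) (h : Z -> Y) :
  pull_hom (g \o h) =
  @hcomp _ (wstar_category R) _ _ _ (pull_hom g) (pull_hom h).
Proof. by apply: wstar_hom_eq => a; exact: space_eq. Qed.

Let indicator_subproof X (D : set X) x : `|\1_D x : R[i]| <= 1.
Proof. by rewrite indicE; case: (_ \in _); rewrite ?normr1 ?normr0. Qed.

Definition indicator X (D : set X) : linf X :=
  mk_linf (@indicator_subproof X D).

(** The image, under indicators, of the filter of tails of the finite lists ordered by inclusion. *)
Let list_filter X : set_system (linf X) :=
  [set A | exists s, forall t, List.incl s t ->
    A (indicator [set x | List.In x t])].

Let list_filter_proper X : ProperFilter (@list_filter X).
Proof.
split; first by case=> s /(_ s (List.incl_refl _)).
split.
- by exists [::].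
- move=> A B [s sA] [t tB]; exists (s ++ t) => u /List.incl_app_inv[su tu].
  by split; [exact: sA | exact: tB].
- by move=> A B AB [s sA]; exists s => t /sA /AB.
Qed.

(** Up to a small error [v] only sees the finitely many points of some [s], where the indicator of
    any larger list agrees with [1]. *)
Let list_filter_cvg X : @list_filter X --> (cone : weak_star (W X)).
Proof.
have FF := list_filter_proper X.
apply: (@weak_star_cvg R (W X) (@list_filter X) cone _) => v.
(* A quarter of [e]: elements of norm at most [1] double the error in [pairing_approx], and two of
   them are compared. *)
apply/cvgrPdist_le => e e0; have e40 : 0 < e / 2 / 2 by rewrite !divr_gt0.
have [s vs] := predual_approx v e40.
exists [seq p.2 | p <- s] => t st /=.
have bound a : `|a : linf X| <= 1 -> `|pairing a v - comb s a| <= e / 2.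
  move=> a1; rewrite (le_trans (pairing_approx a vs))//.
  rewrite -[e / 2 in leRHS](@divfK _ 2)// [leRHS]mulrC -{2}[2]/(1 + 1).
  by rewrite ler_wpM2r ?lerD// ltW.
rewrite [e]splitr (le_trans (ler_distD (comb s (fun=> 1)) _ _))// lerD//.
  by apply: bound; apply: space_norm_le => // x; rewrite normr1.
have -> : comb s (fun=> 1) = comb s (indicator [set x | List.In x t]).
  rewrite /comb; elim: s {vs bound} st => [|p s IH] st; first by rewrite !big_nil.
  rewrite !big_cons IH => [|x sx]; last by apply: st; right.
  by rewrite /= indicE mem_set//; apply: st; left.
rewrite distrC bound//; apply: space_norm_le => //.
exact: indicator_subproof.
Qed.

(** By normality [f cone] is the weak-star limit of the images of the finite indicators, all of them
    [0]. *)
Lemma normal_one_eq0 X (M : wstarAlg R) (f : wstar_hom (W X) M) :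
  (forall s, sval f (indicator [set x | List.In x s]) = 0) ->
  (cone : cstar_of M) = 0.
Proof.
case: f => f [fl fm f1 fs fc] /= f0.
have FF := list_filter_proper X.
apply: weak_star_hausdorff => v; rewrite -f1.
have cont : (fun a => ev (f a) v : R[i]^o) @ nbhs (cone : weak_star (W X))
    --> (ev (f cone) v : R[i]^o).
  exact: (@continuous_comp (weak_star (W X)) (weak_star M) R[i]^o f _ cone
     (fc cone) (@weak_star_ev_continuous R M v (f cone))).
have cvg1 := cvg_trans (cvg_app _ (@list_filter_cvg X)) cont.
have cvg0 : (fun a => ev (f a) v : R[i]^o) @ @list_filter X
    --> (ev 0 v : R[i]^o).
  by apply: cvg_near_cst; exists [::] => t _ /=; rewrite f0.
exact: (cvg_unique (@norm_hausdorff _ _) cvg1 cvg0).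
Qed.
End linf_functor.

(** * Thin sets and the vanishing diagram *)

Section thin_sets.
Context (K : small).

(* [index] surjects onto [K * index] and onto [nat]: sets covered by [index]
   are thus stable under unions of [K] many of them and include the finite
   sets. *)
Let index : small := nat -> K + nat.
Definition points : small := set index.

Definition thin (S : set points) : Prop :=
  exists g : index -> points, S `<=` range g.

Lemma thin_list s : thin [set x | List.In x s].
Proof.
(* The first entry of [q] encodes a position in the list; [set0] is only a default value. *)
exists (fun q => if q 0%N is inr n then List.nth n s set0 else set0) => x xs.
have [n [_ xn]] := List.In_nth _ _ set0 xs.
by exists (fun=> inr n).
Qed.

Lemma thin_setU S T : thin S -> thin T -> thin (S `|` T).
Proof.
move=> [g Sg] [h Th].
(* The first entry selects one of the two covers, and the shifted sequence is passed on to it. *)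
exists (fun q => (if q 0%N is inr 0%N then g else h) (fun n => q n.+1)) => x.
case=> [/Sg[q _ <-]|/Th[q _ <-]].
  by exists (fun n => if n is m.+1 then q m else inr 0%N).
by exists (fun n => if n is m.+1 then q m else inr 1%N).
Qed.

(** Cantor's diagonal argument: [points] is the power set of [index]. *)
Lemma thin_proper S : thin S -> exists x, ~ S x.
Proof.
move=> [g Sg]; exists [set q | ~ g q q] => /Sg[q _ gq].
have : g q q <-> ~ g q q by rewrite {1}gq.
by case=> h1 h2; have h : ~ g q q := fun h => h1 h h; exact: h (h2 h).
Qed.

Definition thin_set : small := {S : set points | thin S}.

Definition thin_le : relation thin_set := fun S T => sval S `<=` sval T.

Lemma thin_order : order thin_set thin_le.
Proof.
split.
- by move=> S x.
- by move=> S T U ST TU x /ST /TU.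
- by move=> [S Sthin] [T Tthin] ST TS; apply: eq_exist; apply/seteqP.
Qed.

Lemma thin_directed : directed K thin_le.
Proof.
move=> A [/card_leP[f] _].
pose G (S : thin_set) : index -> points := sval (cid (svalP S)).
have GP S : sval S `<=` range (G S) := svalP (cid (svalP S)).
(* The first entry of [q] names a member of [A] through the injection [f] into [K]; the remaining
   entries index the chosen cover of that member. *)
pose g (q : index) : points :=
  if q 0%N is inl k then
    if pselect (exists S : A, val (f S) = k) is left h then
      G (val (sval (cid h))) (fun n => q n.+1)
    else set0
  else set0.
have Uthin : thin (\bigcup_(S in A) sval S).
  exists g => x [S AS /GP[q _ <-]]; pose S' : A := SigSub (mem_set AS).
  exists (fun n => if n is m.+1 then q m else inl (val (f S'))) => //; rewrite /g.
  case: pselect => [h|[]]; last by exists S'.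
  case: (cid h) => T /= /val_inj fT.
  by rewrite (inj (f:=f) _ _ fT) ?in_setT.
by exists (exist _ _ Uthin) => S AS x Sx; exists S.
Qed.
End thin_sets.

(** * The vanishing diagram and characters of presentable algebras *)

Section linf_diagrams.
Context (R : realType).
Let C := wstar_category R.
Let W X := linf_wstar R X.

Section vanishing_diagram.
Context (K : small).
Let J := thin_set K.
Let co (S : J) : small := {x : points K | ~ sval S x}.

Let restrict (S T : J) (ST : thin_le S T) (x : co T) : co S :=
  exist (fun y => ~ sval S y) (sval x) (fun Sx => svalP x (ST _ Sx)).

Let shrink (S T : J) (ST : thin_le S T) : Defs.hom C (W (co S)) (W (co T)) :=
  pull_hom R (restrict ST).

Let shrink_id S : shrink (ord_refl _ _ (thin_order K) S) = idc C (W (co S)).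
Proof.
rewrite -pull_hom_id; apply: pull_hom_ext => -[x Sx]; exact: eq_exist.
Qed.

Let shrink_comp S T U (ST : thin_le S T) (TU : thin_le T U) :
  shrink (ord_trans _ _ (thin_order K) _ _ _ ST TU) =
  hcomp (shrink ST) (shrink TU).
Proof.
by rewrite -pull_hom_comp; apply: pull_hom_ext => -[x Sx]; exact: eq_exist.
Qed.

Definition vanishing : functor (poset_category (thin_order K)) C :=
  @Functor _ _ (poset_category (thin_order K)) C (fun S => W (co S))
    shrink shrink_id shrink_comp.

Let hom_void_eq (A : wstarAlg R) (f g : Defs.hom C A (W void)) : f = g.
Proof. by apply: wstar_hom_eq => a; apply: space_eq. Qed.

(** The apex [W void] is the zero algebra, into which any two parallel maps agree. *)
Definition vanishing_cocone : cocone vanishing.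
Proof.
exists (W void) (fun S => pull_hom R (fun x : void => match x with end)).
by move=> S T u; exact: hom_void_eq.
Defined.

(** The zero map is unital exactly because [cone = 0] in [M]. *)
Let hom_from_void (M : wstarAlg R) :
  (cone : cstar_of M) = 0 -> Defs.hom C (W void) M.
Proof.
move=> /zero_wstar M0; exists (fun=> 0); split; try by move=> *; exact: M0.
  by move=> k a b; exact: M0.
exact: (@cst_continuous (weak_star (W void)) (weak_star M) 0).
Defined.

Let thin_of (s : seq (points K)) : J := exist _ _ (thin_list s).

Lemma vanishing_cocone_trivial (y : cocone vanishing) :
  (cone : cstar_of (apex y)) = 0.
Proof.
apply: (normal_one_eq0 (f := leg y (thin_of [::]))) => s.
(* The leg at the empty set factors through restriction to the complement of [s], which kills the
   indicator of [s]. *)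
have u : thin_le (thin_of [::]) (thin_of [seq sval x | x <- s]) by [].
rewrite -(leg_natural y u) /=.
set f := leg y _.
rewrite (_ : pull _ _ = 0).
  have [fl _ _ _ _] := svalP f.
  by have := fl (-1) 0 0; rewrite scaler0 addr0 scaleN1r addNr.
apply: space_eq => x; rewrite /= indicE memNset//= => xs.
by apply: (svalP x); apply: (List.in_map sval _ _ xs).
Qed.

Lemma vanishing_colimit : is_colimit vanishing_cocone.
Proof.
move=> y; have one0 := vanishing_cocone_trivial y.
exists (hom_from_void one0); split=> [S|h _]; apply: wstar_hom_eq => a;
  exact: zero_wstar.
Qed.

(* In the colimit of sets, characters of [c] repeated on every point off [S]
   become equal as [S] grows, whereas evaluating at the remaining points
   recovers them at each stage. *)
Lemma presentable_character (c : wstarAlg R) :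
  presentable K C c -> forall chi0 chi1 : Defs.hom C c (W unit), chi0 = chi1.
Proof.
move=> /(_ _ _ _ (@thin_directed K) _ _ vanishing_colimit) colim chi0 chi1.
pose at_ S (x : co S) : Defs.hom C (W (co S)) (W unit) := pull_hom R (fun=> x).
pose spread (chi : Defs.hom C c (W unit)) S : Defs.hom C c (W (co S)) :=
  hcomp chi (pull_hom R (fun=> tt)).
have spreadK chi S (x : co S) : hcomp (spread chi S) (at_ S x) = chi.
  by apply: wstar_hom_eq => a; apply: space_eq => -[].
(* The colimit is tested against [Prop]: agreeing with [chi0] off a thin set is preserved and
   reflected by restriction, so it descends to maps into the apex. *)
pose eventually S (h : Defs.hom C c (W (co S))) : Prop :=
  exists2 U, thin U & forall x : co S, ~ U (sval x) -> hcomp h (at_ S x) = chi0.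
have natural S T (u : thin_le S T) :
    @hcomp _ set_category _ _ _
      (Defs.fmap (functor_comp vanishing (hom_functor C c)) u) (eventually T) =
    eventually S.
  have shrinkK (h : Defs.hom C c (W (co S))) x :
      hcomp (hcomp h (shrink u)) (at_ T x) = hcomp h (at_ S (restrict u x)).
    by apply: wstar_hom_eq => a; exact: space_eq.
  apply/funext => h; apply/propext; split=> -[U Uthin hU].
    (* Nothing is known at the points lost by restricting to [co T]; they form a thin set and join
       the exceptions. *)
    exists (sval T `|` U); first exact: thin_setU (svalP T) Uthin.
    move=> [x Sx] /= /not_orP[Tx Ux].
    rewrite -(hU (exist _ x Tx) Ux) shrinkK; congr (hcomp h (at_ S _)).
    exact: eq_exist.
  exists U => // x Ux; rewrite -(hU (restrict u x) Ux); exact: shrinkK.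
have [h [hP _]] := colim (@Cocone _ _ _ set_category
  (functor_comp vanishing (hom_functor C c)) Prop eventually natural).
pose S0 := thin_of [::].
have hE chi : h (hcomp (spread chi S0) (leg vanishing_cocone S0)) =
    eventually S0 (spread chi S0).
  by have /(congr1 (fun p => p (spread chi S0))) := hP S0.
(* In the colimit both spread characters have the same image, so the property passes from [chi0] to
   [chi1]. *)
have spread_eq : hcomp (spread chi0 S0) (leg vanishing_cocone S0) =
    hcomp (spread chi1 S0) (leg vanishing_cocone S0) by exact: hom_void_eq.
have : eventually S0 (spread chi0 S0).
  by exists set0 => [|x _]; [exact: (thin_list [::]) | exact: spreadK].
rewrite -hE spread_eq hE.
case=> U /thin_proper[x Ux] /(_ (exist _ x id) Ux).
by rewrite spreadK.
Qed.

End vanishing_diagram.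

End linf_diagrams.

Theorem corollary4p3 (R : realType) :
  ~ locally_presentable (wstar_category R).
Proof.
pose C := wstar_category R; pose W X := linf_wstar R X.
move=> [K [_ [_ [I [S [Spres gen]]]]]].
have [J [le [leo [F [x [_ FS xC colim]]]]]] := gen (W bool).
(* These are the two coordinate characters of C^2. *)
pose e b : Defs.hom C (W bool) (W unit) := pull_hom R (fun=> b).
have e_neq : e true <> e false.
  move=> /(congr1 (fun h : wstar_hom (W bool) (W unit) =>
    space_fun (sval h (indicator R [set true])) tt)).
  rewrite /= !indicE mem_set// memNset// => /eqP.
  by rewrite oner_eq0.
case: x xC colim => A l ln /= AE; move: l ln; rewrite AE => l ln colim.
have le_eq j : hcomp (l j) (e true) = hcomp (l j) (e false).
  have [i Fj] := FS j; move: (hcomp _ _) (hcomp _ _).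
  by rewrite Fj => f g; exact: (presentable_character (Spres i)).
have natural i j (u : Defs.hom (poset_category leo) i j) :
    hcomp (Defs.fmap F u) (hcomp (l j) (e true)) = hcomp (l i) (e true).
  by rewrite comp_assoc ln.
(* Both [e true] and [e false] mediate to this cocone, so uniqueness would identify them. *)
have [h [_ hU]] := colim (Cocone natural).
by apply: e_neq; rewrite -(hU (e true)) // -(hU (e false)).
Qed.
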